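(* Let $S_1,S_2,S_3>0$ be real numbers. 1) If $\tfrac12S_1<S_2$, then there exist two different (non-congruent) triangles $A_1B_1C_1$ and $A_2B_2C_2$ such that, for $i=1,2$, the height of $A_iB_iC_i$ from $B_i$ equals $S_1$, the median from $A_i$ equals $S_2$, and the bisector from $C_i$ equals $S_3$; in these triangles the median from $A_1$ makes the angle $\alpha$ with the base $A_1C_1$ (i.e. $\angle M_1A_1C_1=\alpha$), and the median from $A_2$ makes the angle $\pi-\alpha$ with the base $A_2C_2$ (i.e. $\angle M_2A_2C_2=\pi-\alpha$), where $M_i$ is the midpoint of $B_iC_i$, $\alpha=\arcsin\left(S_1/(2S_2)\right)$ and $0<\alpha<\pi/2$. 2) If $\tfrac12S_1=S_2$, then there exists a single triangle $ABC$ with $h_b=S_1$, $m_a=S_2$ and $l_c=S_3$.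
   Context: For a non-degenerate triangle $ABC$ in the Euclidean plane, $h_b$ is the length of the height (altitude) from $B$ onto the line $CA$, $m_a$ is the length of the median from $A$ to the midpoint of $BC$, and $l_c$ is the length of the internal angle bisector from $C$, measured from $C$ to the side $AB$. Triangles are considered up to congruence. *)

(* Defs.v *)
From Stdlib Require Import Reals List Permutation.
Import ListNotations.
Open Scope R_scope.

(** The Euclidean plane is [R * R], both for points and for vectors. *)
Definition point : Type := (R * R)%type.

Definition vec (P Q : point) : point := (fst Q - fst P, snd Q - snd P).

Definition dot (u v : point) : R := fst u * fst v + snd u * snd v.

Definition cross (u v : point) : R := fst u * snd v - snd u * fst v.

Definition pdist (P Q : point) : R := dist_euc (fst P) (snd P) (fst Q) (snd Q).

Definition midpoint (P Q : point) : point :=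
  ((fst P + fst Q) / 2, (snd P + snd Q) / 2).

(** The unoriented angle [PQX] with vertex [Q], in [[0, PI]]; it is only
    meaningful when [P <> Q] and [X <> Q]. *)
Definition angle (P Q X : point) : R :=
  acos (dot (vec Q P) (vec Q X) / (pdist Q P * pdist Q X)).

(** The point with parameter [t] on the line [PQ] ([P] at 0, [Q] at 1). *)
Definition line_point (P Q : point) (t : R) : point :=
  (fst P + t * (fst Q - fst P), snd P + t * (snd Q - snd P)).

Definition on_line (P Q X : point) : Prop := exists t : R, X = line_point P Q t.

Definition on_segment (P Q X : point) : Prop :=
  exists t : R, 0 <= t <= 1 /\ X = line_point P Q t.

(** Triangles have labelled vertices, because the roles of the vertices in
    "height from B, median from A, bisector from C" are different. *)
Record plane_triangle : Type := PlaneTriangle {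
  vA : point;
  vB : point;
  vC : point;
  nondegenerate : cross (vec vA vB) (vec vA vC) <> 0
}.

Definition vertices (T : plane_triangle) : list point := [vA T; vB T; vC T].

(** In a non-degenerate triangle the foot [H] of the altitude and the foot [D]
    of the internal bisector below exist and are unique, so each of these two
    relations determines exactly one length. *)
Definition is_height_b (T : plane_triangle) (h : R) : Prop :=
  exists H : point,
    on_line (vC T) (vA T) H /\
    dot (vec (vB T) H) (vec (vC T) (vA T)) = 0 /\
    pdist (vB T) H = h.

Definition is_bisector_c (T : plane_triangle) (l : R) : Prop :=
  exists D : point,
    on_segment (vA T) (vB T) D /\
    angle (vA T) (vC T) D = angle D (vC T) (vB T) /\
    pdist (vC T) D = l.

Definition median_foot_a (T : plane_triangle) : point := midpoint (vB T) (vC T).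

Definition median_a (T : plane_triangle) : R := pdist (vA T) (median_foot_a T).

Definition has_data (T : plane_triangle) (h m l : R) : Prop :=
  is_height_b T h /\ median_a T = m /\ is_bisector_c T l.

Definition isometry (f : point -> point) : Prop :=
  forall P Q : point, pdist (f P) (f Q) = pdist P Q.

(** Congruence respecting the labels: A to A, B to B, C to C. *)
Definition congruent (T T' : plane_triangle) : Prop :=
  exists f : point -> point, isometry f /\ map f (vertices T) = vertices T'.

(** Congruence as plane figures, under any correspondence of the vertices;
    it is implied by [congruent]. *)
Definition congruent_figures (T T' : plane_triangle) : Prop :=
  exists f : point -> point,
    isometry f /\ Permutation (map f (vertices T)) (vertices T').

(* Main.v *)
Require Import Defs.
From Stdlib Require Import Reals Lra Psatz List Permutation.
Import ListNotations.
Open Scope R_scope.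

(** Put [A] at the origin and [C = (b, 0)].  The height and the median fix the
    midpoint [M = (k, h/2)] of [BC] with [k = m cos alpha] or [k = - m cos alpha],
    so that [B = (2 k - b, h)] and only [b > 0] is free.  The bisector length is
    [0] at [b = 0] and unbounded, so the intermediate value theorem gives a
    triangle for each sign of [k].  A congruence between the two triangles
    preserves the area, hence [b], and then comparing the other two sides gives
    [k = 0] or [b = - 4 k], both impossible for [k > 0].  When [h = 2 m] one has [k = 0], and the bisector
    length is strictly increasing in [b], so the three sides are determined. *)

(** * Distances through dot and cross products *)

Lemma pdist_dot (P Q : point) : pdist P Q = sqrt (dot (vec P Q) (vec P Q)).
Proof.
unfold pdist, dist_euc, dot, vec, Rsqr; simpl; f_equal; ring.
Qed.

Lemma dot_self_nonneg (u : point) : 0 <= dot u u.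
Proof. unfold dot; nra. Qed.

Lemma dot_self_eq_0 (u : point) : dot u u = 0 -> u = (0, 0).
Proof.
intro H; destruct (Rplus_sqr_eq_0 (fst u) (snd u) H) as [H1 H2].
rewrite (surjective_pairing u), H1, H2; reflexivity.
Qed.

Lemma pdist_nonneg (P Q : point) : 0 <= pdist P Q.
Proof. rewrite pdist_dot; apply sqrt_pos. Qed.

Lemma pdist_sq (P Q : point) : pdist P Q * pdist P Q = dot (vec P Q) (vec P Q).
Proof. rewrite pdist_dot; apply sqrt_sqrt, dot_self_nonneg. Qed.

Lemma pdist_pos (P Q : point) : dot (vec P Q) (vec P Q) <> 0 -> 0 < pdist P Q.
Proof.
intro H; rewrite pdist_dot; apply sqrt_lt_R0.
pose proof (dot_self_nonneg (vec P Q)); lra.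
Qed.

Lemma pdist_eq_intro (P Q : point) (d : R) :
  0 <= d -> dot (vec P Q) (vec P Q) = d * d -> pdist P Q = d.
Proof. intros Hd H; rewrite pdist_dot, H; apply sqrt_square, Hd. Qed.

Lemma Rsq_eq_nonneg (x y : R) : 0 <= x -> 0 <= y -> x * x = y * y -> x = y.
Proof. intros Hx Hy H; apply Rsqr_inj; auto. Qed.

(** Lagrange's identity: it turns the vanishing or the sign of one product into information on the
    other, and also gives Cauchy-Schwarz. *)
Lemma dot_cross_sq (u v : point) :
  dot u v * dot u v + cross u v * cross u v = dot u u * dot v v.
Proof. unfold dot, cross; ring. Qed.

(** Cauchy-Schwarz puts the argument of [acos] in [angle] inside the interval where [acos] is
    injective. *)
Lemma cos_bound (P Q X : point) :
  0 < pdist Q P -> 0 < pdist Q X ->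
  -1 <= dot (vec Q P) (vec Q X) / (pdist Q P * pdist Q X) <= 1.
Proof.
intros HP HX.
pose proof (dot_cross_sq (vec Q P) (vec Q X)) as E.
rewrite <- !pdist_sq in E.
set (x := dot (vec Q P) (vec Q X)) in *.
set (n := pdist Q P * pdist Q X).
assert (Hn : 0 < n) by (apply Rmult_lt_0_compat; assumption).
assert (Hx : x * x <= n * n) by (unfold n; nra).
assert (B : - n <= x <= n) by (split; nra).
split; apply Rmult_le_reg_r with n; try exact Hn;
  replace (x / n * n) with x by (field; lra); lra.
Qed.

Lemma acos_inj (x y : R) :
  -1 <= x <= 1 -> -1 <= y <= 1 -> acos x = acos y -> x = y.
Proof. intros Hx Hy H; rewrite <- (cos_acos x), <- (cos_acos y), H; auto. Qed.

Lemma triangle_sides_pos (T : plane_triangle) :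
  0 < pdist (vC T) (vA T) /\ 0 < pdist (vC T) (vB T).
Proof.
pose proof (nondegenerate T) as nd.
split; apply pdist_pos; intro H; apply nd; apply dot_self_eq_0 in H;
  unfold cross, vec in *; injection H as H1 H2.
- replace (fst (vC T)) with (fst (vA T)) by lra.
  replace (snd (vC T)) with (snd (vA T)) by lra; simpl; ring.
- replace (fst (vC T)) with (fst (vB T)) by lra.
  replace (snd (vC T)) with (snd (vB T)) by lra; simpl; ring.
Qed.

(** * Height and bisector as polynomial equations *)

(** Both sides of the equation are the squared double area; the foot of the altitude is thereby
    eliminated. *)
Lemma is_height_b_iff (T : plane_triangle) (h : R) :
  is_height_b T h <->
  0 <= h /\
  h * h * dot (vec (vC T) (vA T)) (vec (vC T) (vA T)) =
  cross (vec (vA T) (vB T)) (vec (vA T) (vC T)) *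
  cross (vec (vA T) (vB T)) (vec (vA T) (vC T)).
Proof.
destruct (triangle_sides_pos T) as [Hb _].
pose proof (pdist_sq (vC T) (vA T)) as Hq.
assert (Hq0 : 0 < dot (vec (vC T) (vA T)) (vec (vC T) (vA T))) by nra.
clear Hb Hq; destruct T as [A B C nd]; simpl in *; split.
- intros (H & (t & Ht) & Hperp & Hd); simpl in *.
  pose proof (pdist_nonneg B H) as Hd0; rewrite Hd in Hd0.
  split; [exact Hd0|].
  pose proof (pdist_sq B H) as E; rewrite Hd in E; rewrite E.
  rewrite <- dot_cross_sq, Hperp, Ht.
  unfold dot, cross, vec, line_point; simpl; ring.
- intros [Hh E].
  (* The parameter of the orthogonal projection of [B] onto the line [CA]. *)
  exists (line_point C A (- dot (vec B C) (vec C A) / dot (vec C A) (vec C A)));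
    simpl.
  assert (Hp : dot (vec B (line_point C A
      (- dot (vec B C) (vec C A) / dot (vec C A) (vec C A)))) (vec C A) = 0).
  { unfold dot, vec, line_point in *; simpl in *; field; lra. }
  split; [eexists; reflexivity|]; split; [exact Hp|].
  apply pdist_eq_intro; [exact Hh|].
  apply Rmult_eq_reg_r with (dot (vec C A) (vec C A)); [|lra].
  rewrite E, <- dot_cross_sq, Hp.
  unfold dot, cross, vec, line_point; simpl; ring.
Qed.

(** This is [l = 2ab cos(C/2) / (a + b)], squared, with [2 cos^2(C/2) = 1 + cos C] and [ab cos C]
    written as a dot product. *)
Lemma is_bisector_c_iff (T : plane_triangle) (l : R) :
  let a := pdist (vC T) (vB T) in
  let b := pdist (vC T) (vA T) in
  is_bisector_c T l <->
  0 <= l /\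
  l * l * ((a + b) * (a + b)) =
  2 * (a * b) * (a * b + dot (vec (vC T) (vA T)) (vec (vC T) (vB T))).
Proof.
intros a b.
destruct (triangle_sides_pos T) as [Hb Ha]; fold a in Ha; fold b in Hb.
pose proof (pdist_sq (vC T) (vB T)) as Ea; fold a in Ea.
pose proof (pdist_sq (vC T) (vA T)) as Eb; fold b in Eb.
pose proof (dot_cross_sq (vec (vC T) (vA T)) (vec (vC T) (vB T))) as Ecs.
set (s := dot (vec (vC T) (vA T)) (vec (vC T) (vB T))) in *.
assert (nd : cross (vec (vC T) (vA T)) (vec (vC T) (vB T)) <> 0).
{ intro H; apply (nondegenerate T); rewrite <- H; unfold cross, vec; simpl; ring. }
assert (dD1 : forall t, dot (vec (vC T) (vA T))
    (vec (vC T) (line_point (vA T) (vB T) t)) = (1 - t) * (b * b) + t * s).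
{ intro t; rewrite Eb; unfold s, dot, vec, line_point; simpl; ring. }
assert (dD2 : forall t, dot (vec (vC T) (line_point (vA T) (vB T) t))
    (vec (vC T) (vB T)) = (1 - t) * s + t * (a * a)).
{ intro t; rewrite Ea; unfold s, dot, vec, line_point; simpl; ring. }
assert (dD3 : forall t, dot (vec (vC T) (line_point (vA T) (vB T) t))
    (vec (vC T) (line_point (vA T) (vB T) t)) =
    (1 - t) * (1 - t) * (b * b) + 2 * t * (1 - t) * s + t * t * (a * a)).
{ intro t; rewrite Ea, Eb; unfold s, dot, vec, line_point; simpl; ring. }
(* Cauchy-Schwarz is strict because the cross product [nd] does not vanish. *)
assert (Hs : s * s < (a * b) * (a * b)).
{ replace (a * b * (a * b)) with (a * a * (b * b)) by ring.
  rewrite Ea, Eb, (Rmult_comm (dot (vec (vC T) (vB T)) _)), <- Ecs; nra. }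
assert (Hab : 0 < a * b) by (apply Rmult_lt_0_compat; assumption).
assert (Hs' : 0 < a * b - s) by nra.
(* The hypothesis on [t] is the bisector theorem [AD : DB = b : a]; the left factor is then
   [CD^2]. *)
assert (key : forall t, t * (a + b) = b ->
    ((1 - t) * (1 - t) * (b * b) + 2 * t * (1 - t) * s + t * t * (a * a)) *
    ((a + b) * (a + b)) = 2 * (a * b) * (a * b + s)).
{ intros t Ht.
  assert (t = b / (a + b)) by (apply Rmult_eq_reg_r with (a + b);
    [rewrite Ht; field; lra | lra]).
  subst t; field; lra. }
clear Ecs; split.
- intros (D & (t & Ht & HD) & Hang & Hl); subst D.
  set (D := line_point (vA T) (vB T) t) in *.
  pose proof (pdist_nonneg (vC T) D) as Hl0.
  (* If [D = C], then both [t] and [1 - t] times the nonzero cross product vanish, which is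
     absurd. *)
  assert (HlD : 0 < pdist (vC T) D).
  { apply pdist_pos; intro H0.
    pose proof (dot_self_eq_0 _ H0) as Z.
    apply nd.
    assert (Z1 : cross (vec (vC T) (vA T)) (vec (vC T) D) =
      t * cross (vec (vC T) (vA T)) (vec (vC T) (vB T)))
      by (unfold D, cross, vec, line_point; simpl; ring).
    assert (Z2 : cross (vec (vC T) D) (vec (vC T) (vB T)) =
      (1 - t) * cross (vec (vC T) (vA T)) (vec (vC T) (vB T)))
      by (unfold D, cross, vec, line_point; simpl; ring).
    rewrite Z in Z1, Z2; unfold cross at 1 in Z1; unfold cross at 1 in Z2.
    simpl in Z1, Z2; lra. }
  unfold angle in Hang; apply acos_inj in Hang; try (apply cos_bound; assumption).
  fold a b in Hang; unfold D in Hang at 1 3; rewrite dD1, dD2 in Hang.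
  split; [lra|].
  rewrite <- Hl, pdist_sq; unfold D; rewrite dD3; apply key.
  assert (Hx : ((1 - t) * (b * b) + t * s) * a = ((1 - t) * s + t * (a * a)) * b).
  { apply (f_equal (fun x => x * (a * b * pdist (vC T) D))) in Hang.
    transitivity (((1 - t) * (b * b) + t * s) / (b * pdist (vC T) D) *
      (a * b * pdist (vC T) D)); [field; lra|].
    rewrite Hang; field; lra. }
  (* Equality of the two cosines factors this way, and the first factor is positive. *)
  assert ((a * b - s) * (t * (a + b) - b) = 0) by lra.
  nra.
- intros [Hl E].
  set (t := b / (a + b)).
  assert (Ht : t * (a + b) = b) by (unfold t; field; lra).
  exists (line_point (vA T) (vB T) t); split; [exists t; split; [nra|reflexivity]|].
  split.
  + unfold angle; f_equal; fold a b; rewrite dD1, dD2.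
    unfold Rdiv; rewrite !Rinv_mult.
    rewrite (Rmult_comm (/ pdist (vC T) _)), <- !Rmult_assoc; f_equal.
    unfold t; field; lra.
  + apply pdist_eq_intro; [exact Hl|].
    apply Rmult_eq_reg_r with ((a + b) * (a + b)); [|nra].
    rewrite dD3, E; apply key, Ht.
Qed.

(** * Congruence from equal dot products *)

(* The vector isometry is [x -> ((x.v) v' + e (v x x) J v') / |v|^2] with
   [v = AC], [v' = A'C'], [J] the quarter turn and [e = 1] or [-1] according to
   whether the two triangles have the same orientation. *)
Lemma congruent_of_eq_dots (T T' : plane_triangle) :
  dot (vec (vA T) (vC T)) (vec (vA T) (vC T)) =
    dot (vec (vA T') (vC T')) (vec (vA T') (vC T')) ->
  dot (vec (vA T) (vB T)) (vec (vA T) (vB T)) =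
    dot (vec (vA T') (vB T')) (vec (vA T') (vB T')) ->
  dot (vec (vA T) (vB T)) (vec (vA T) (vC T)) =
    dot (vec (vA T') (vB T')) (vec (vA T') (vC T')) ->
  congruent T T'.
Proof.
destruct T as [[a1 a2] [b1 b2] [c1 c2] nd].
destruct T' as [[a1' a2'] [b1' b2'] [c1' c2'] nd']; simpl.
unfold dot, cross, vec in *; simpl in *.
set (w1 := b1 - a1) in *; set (w2 := b2 - a2) in *.
set (v1 := c1 - a1) in *; set (v2 := c2 - a2) in *.
set (w1' := b1' - a1') in *; set (w2' := b2' - a2') in *.
set (v1' := c1' - a1') in *; set (v2' := c2' - a2') in *.
intros Ev Ew Es.
set (q := v1 * v1 + v2 * v2) in *.
assert (Hq : q <> 0).
{ intro H; apply nd; destruct (Rplus_sqr_eq_0 v1 v2 H) as [H1 H2].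
  rewrite H1, H2; ring. }
(* By Lagrange's identity the dot products determine the cross product up to the sign [e]. *)
assert (He : exists e, e * e = 1 /\ v1' * w2' - v2' * w1' = e * (v1 * w2 - v2 * w1)).
{ assert ((v1' * w2' - v2' * w1') * (v1' * w2' - v2' * w1') =
          (v1 * w2 - v2 * w1) * (v1 * w2 - v2 * w1)) as H.
  { transitivity ((v1' * v1' + v2' * v2') * (w1' * w1' + w2' * w2') -
      (w1' * v1' + w2' * v2') * (w1' * v1' + w2' * v2')); [ring|].
    rewrite <- Ev, <- Ew, <- Es; unfold q; ring. }
  destruct (Rsqr_eq _ _ H) as [H1|H1]; [exists 1 | exists (-1)]; split; lra. }
destruct He as (e & He & Hd).
exists (fun P =>
  (a1' + (((fst P - a1) * v1 + (snd P - a2) * v2) * v1'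
     - e * (v1 * (snd P - a2) - v2 * (fst P - a1)) * v2') / q,
   a2' + (((fst P - a1) * v1 + (snd P - a2) * v2) * v2'
     + e * (v1 * (snd P - a2) - v2 * (fst P - a1)) * v1') / q)).
split.
- intros [p1 p2] [r1 r2]; rewrite !pdist_dot; f_equal; unfold dot, vec; simpl.
  set (x := r1 - p1); set (y := r2 - p2).
  (* The components of the image along [v'] and [J v'] are orthogonal, so their squares add up;
     Lagrange's identity then restores the length of [(x, y)]. *)
  transitivity ((((x * v1 + y * v2) * (x * v1 + y * v2) +
    (e * e) * ((v1 * y - v2 * x) * (v1 * y - v2 * x))) *
    (v1' * v1' + v2' * v2')) / (q * q)).
  + unfold x, y; field; exact Hq.
  + rewrite He, <- Ev.
    replace ((x * v1 + y * v2) * (x * v1 + y * v2) +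
      1 * ((v1 * y - v2 * x) * (v1 * y - v2 * x))) with ((x * x + y * y) * q)
      by (unfold q; ring).
    field; exact Hq.
- assert (K : forall z1 z2 d1 d2 y1 y2, d1 = (y1 - z1) * q -> d2 = (y2 - z2) * q ->
    (z1 + d1 / q, z2 + d2 / q) = (y1, y2)).
  { intros; subst; f_equal; field; exact Hq. }
  unfold vertices; simpl; f_equal; [|f_equal; [|f_equal]].
  + apply K; ring.
  + apply K; fold w1 w2 w1' w2'.
    * transitivity ((w1 * v1 + w2 * v2) * v1' - e * (v1 * w2 - v2 * w1) * v2');
        [ring|].
      rewrite <- Hd, Es, Ev; ring.
    * transitivity ((w1 * v1 + w2 * v2) * v2' + e * (v1 * w2 - v2 * w1) * v1');
        [ring|].
      rewrite <- Hd, Es, Ev; ring.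
  + apply K; fold v1 v2 v1' v2'; fold q.
    * transitivity (q * v1'); [unfold q; ring|ring].
    * transitivity (q * v2'); [unfold q; ring|ring].
Qed.

(** * Existence by the intermediate value theorem *)

Lemma continuity_sqrt_comp (f : R -> R) :
  continuity f -> (forall x, 0 <= f x) -> continuity (fun x => sqrt (f x)).
Proof.
intros Hf H x; apply (continuity_pt_comp f sqrt); [apply Hf|].
apply continuity_pt_sqrt, H.
Qed.

(** The equation of [is_bisector_c_iff] for [A = (0, 0)], [B = (2k - b, h)], [C = (b, 0)]: here [a]
    is [CB] and [2b(b - k)] is the dot product at [C]. *)
Lemma bisector_equation_solvable (h k l : R) : 0 < h -> 0 < l ->
  exists b, 0 < b /\
    let a := sqrt (4 * ((b - k) * (b - k)) + h * h) in
    l * l * ((a + b) * (a + b)) = 2 * (a * b) * (a * b + 2 * b * (b - k)).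
Proof.
intros Hh Hl.
set (A := fun b => sqrt (4 * ((b - k) * (b - k)) + h * h)).
assert (HP : forall b, 0 < 4 * ((b - k) * (b - k)) + h * h)
  by (intro b; pose proof (Rle_0_sqr (b - k)); unfold Rsqr in *; nra).
assert (HA : forall b, 0 < A b) by (intro b; apply sqrt_lt_R0, HP).
assert (HA2 : forall b, A b * A b = 4 * ((b - k) * (b - k)) + h * h)
  by (intro b; apply sqrt_sqrt, Rlt_le, HP).
assert (cA : continuity A).
{ apply continuity_sqrt_comp; [reg|intro x; apply Rlt_le, HP]. }
set (g := fun b => 2 * (A b * b) * (A b * b + 2 * b * (b - k)) -
                   l * l * ((A b + b) * (A b + b))).
assert (cg : continuity g).
{ assert (cid : continuity (fun b : R => b)) by reg.
  assert (ck : continuity (fun b : R => 2 * b * (b - k))) by reg.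
  assert (c2 : forall c, continuity (fun _ : R => c)) by (intro c; reg).
  apply (continuity_minus
    (fun b => 2 * (A b * b) * (A b * b + 2 * b * (b - k)))
    (fun b => l * l * ((A b + b) * (A b + b)))).
  - apply (continuity_mult (fun b => 2 * (A b * b))
      (fun b => A b * b + 2 * b * (b - k))).
    + apply (continuity_mult (fun _ => 2) (fun b => A b * b)); [apply c2|].
      apply (continuity_mult A (fun b => b)); assumption.
    + apply (continuity_plus (fun b => A b * b) (fun b => 2 * b * (b - k)));
        [apply (continuity_mult A (fun b => b))|]; assumption.
  - apply (continuity_mult (fun _ => l * l) (fun b => (A b + b) * (A b + b)));
      [apply c2|].
    apply (continuity_mult (fun b => A b + b) (fun b => A b + b));
      apply (continuity_plus A (fun b => b)); assumption. }
(* Large enough that [N >= 2l] and [2(N - k) >= N]; the latter yields [A N >= N], so that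
   [l^2 (a + N)^2 <= 4 l^2 a^2 < 2 a^2 N^2]. *)
set (N := 2 * Rabs k + 2 * l).
pose proof (Rabs_pos k); pose proof (Rle_abs k).
assert (HN : 2 * l <= N) by (unfold N; lra).
assert (g0 : g 0 < 0).
{ unfold g; pose proof (HA 0).
  assert (0 < l * l * (A 0 * A 0)) by (repeat apply Rmult_lt_0_compat; assumption).
  lra. }
assert (gN : 0 < g N).
{ assert (Hu : N <= 2 * (N - k)) by (unfold N; lra).
  pose proof (HA N) as HaN; pose proof (HA2 N) as HaN2.
  assert (HNA : N <= A N) by nra.
  unfold g; set (a := A N) in *.
  assert (P1 : (a + N) * (a + N) <= 4 * (a * a)) by nra.
  assert (P2 : a * N <= a * N + 2 * N * (N - k)) by nra.
  assert (P3 : 2 * (a * N) * (a * N) <=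
    2 * (a * N) * (a * N + 2 * N * (N - k))) by (apply Rmult_le_compat_l; nra).
  assert (P4 : l * l * ((a + N) * (a + N)) <= l * l * (4 * (a * a)))
    by (apply Rmult_le_compat_l; nra).
  assert (P5 : 2 * (l * l) < N * N) by nra.
  assert (P6 : a * a * (2 * (l * l)) < a * a * (N * N))
    by (apply Rmult_lt_compat_l; nra).
  lra. }
destruct (IVT g 0 N cg) as (b & [Hb0 HbN] & Hb); [lra|exact g0|exact gN|].
exists b; split.
(* The root is not the endpoint [0], where [g] is negative. *)
- destruct Hb0 as [|E]; [assumption|]. subst b; lra.
- unfold g in Hb; simpl; fold (A b); lra.
Qed.

(** The sign of [k] is free: positive and negative [k] give the two triangles of the first claim,
    [k = 0] the triangle of the second. *)
Lemma triangle_of_median_abscissa (h k l : R) : 0 < h -> 0 < l ->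
  exists (b : R) (T : plane_triangle), 0 < b /\
    vA T = (0, 0) /\ vB T = (2 * k - b, h) /\ vC T = (b, 0) /\
    has_data T h (sqrt (k * k + h / 2 * (h / 2))) l.
Proof.
intros Hh Hl.
destruct (bisector_equation_solvable h k l Hh Hl) as (b & Hb & E).
assert (nd : cross (vec (0, 0) (2 * k - b, h)) (vec (0, 0) (b, 0)) <> 0).
{ unfold cross, vec; simpl; nra. }
exists b, (PlaneTriangle (0, 0) (2 * k - b, h) (b, 0) nd); simpl.
do 4 (split; [reflexivity || assumption|]).
split; [|split].
- apply is_height_b_iff; simpl; split; [lra|]; unfold dot, cross, vec; simpl; ring.
- unfold median_a, median_foot_a, midpoint; simpl; rewrite pdist_dot; f_equal.
  unfold dot, vec; simpl; field.
- apply is_bisector_c_iff; simpl; split; [lra|].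
  replace (pdist (b, 0) (0, 0)) with b
    by (symmetry; apply pdist_eq_intro; [lra|]; unfold dot, vec; simpl; ring).
  replace (pdist (b, 0) (2 * k - b, h)) with
    (sqrt (4 * ((b - k) * (b - k)) + h * h))
    by (rewrite pdist_dot; f_equal; unfold dot, vec; simpl; ring).
  rewrite E; unfold dot, vec; simpl; ring.
Qed.

(** * Uniqueness when the median is half the height *)

(* [2 a b^2 (a + 2 b) / (a + b)^2] is the product of [2 a b / (a + b)] and
   [b (1 + b / (a + b))]; both increase with [b], as [a] increases and
   [a / b] decreases. *)
Lemma bisector_sq_increasing (h l a b a' b' : R) :
  0 < h -> 0 < a -> 0 < b -> 0 < a' -> b < b' ->
  a * a = h * h + 4 * (b * b) -> a' * a' = h * h + 4 * (b' * b') ->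
  l * l * ((a + b) * (a + b)) = 2 * (a * b) * (a * b + 2 * (b * b)) ->
  l * l * ((a' + b') * (a' + b')) = 2 * (a' * b') * (a' * b' + 2 * (b' * b')) ->
  False.
Proof.
intros Hh Ha Hb Ha' Hbb Ea Ea' E E'.
assert (Haa : a < a') by nra.
(* That is, [a / b] decreases. After squaring, the terms [4 b^2 b'^2] cancel and
   [h^2 b^2 < h^2 b'^2] remains. *)
assert (Hr : a' * b < a * b').
{ assert (a' * b * (a' * b) < a * b' * (a * b')).
  { replace (a' * b * (a' * b)) with (a' * a' * (b * b)) by ring.
    replace (a * b' * (a * b')) with (a * a * (b' * b')) by ring.
    rewrite Ea, Ea'.
    assert (b * b < b' * b') by nra.
    assert (h * h * (b * b) < h * h * (b' * b')) by (apply Rmult_lt_compat_l; nra).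
    nra. }
  assert (0 < a' * b) by nra. assert (0 < a * b') by nra. nra. }
(* The inequalities [X < X'] and [Y < Y'] compare the two increasing factors with denominators
   cleared. *)
set (X := a * b * (a' + b')); set (X' := a' * b' * (a + b)).
set (Y := b * (a + 2 * b) * (a' + b')); set (Y' := b' * (a' + 2 * b') * (a + b)).
assert (HX : X < X').
{ unfold X, X'.
  assert (a * a' * b < a * a' * b') by (apply Rmult_lt_compat_l; nra).
  assert (b * b' * a < b * b' * a') by (apply Rmult_lt_compat_l; nra).
  nra. }
assert (HY : Y < Y').
{ unfold Y, Y'; rewrite !Rmult_assoc.
  (* Besides [b < b'], the comparison of the remaining products reduces to [Hr]. *)
  apply Rmult_gt_0_lt_compat; nra. }
assert (X0 : 0 < X) by (unfold X; repeat apply Rmult_lt_0_compat; lra).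
assert (Y0 : 0 < Y) by (unfold Y; repeat apply Rmult_lt_0_compat; lra).
assert (HXY : X * Y < X' * Y') by (apply Rmult_gt_0_lt_compat; lra).
(* Twice either product is [l^2 (a + b)^2 (a' + b')^2]. *)
assert (W : X * Y = X' * Y'); [|lra].
apply Rmult_eq_reg_l with 2; [|lra].
transitivity (2 * (a * b) * (a * b + 2 * (b * b)) * ((a' + b') * (a' + b')));
  [unfold X, Y; ring|].
rewrite <- E.
transitivity (2 * (a' * b') * (a' * b' + 2 * (b' * b')) * ((a + b) * (a + b)));
  [rewrite <- E'; ring|unfold X', Y'; ring].
Qed.

(** A median of length [h / 2] must be perpendicular to [AC], since its endpoint lies at distance
    [h / 2] from that line. So [h] and [b] fix all dot products at [A]. *)
Lemma has_data_right_median (T : plane_triangle) (h l : R) :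
  0 < h -> has_data T h (h / 2) l ->
  let a := pdist (vC T) (vB T) in
  let b := pdist (vC T) (vA T) in
  a * a = h * h + 4 * (b * b) /\
  l * l * ((a + b) * (a + b)) = 2 * (a * b) * (a * b + 2 * (b * b)) /\
  dot (vec (vA T) (vC T)) (vec (vA T) (vC T)) = b * b /\
  dot (vec (vA T) (vB T)) (vec (vA T) (vC T)) = - (b * b) /\
  dot (vec (vA T) (vB T)) (vec (vA T) (vB T)) = h * h + b * b.
Proof.
intros Hh (H1 & H2 & H3) a b.
apply is_height_b_iff in H1; destruct H1 as [_ H1].
apply is_bisector_c_iff in H3; destruct H3 as [_ H3]; fold a b in H3.
pose proof (pdist_sq (vC T) (vB T)) as Ea; fold a in Ea.
pose proof (pdist_sq (vC T) (vA T)) as Eb; fold b in Eb.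
pose proof (pdist_sq (vA T) (median_foot_a T)) as Em.
unfold median_a in H2; rewrite H2 in Em.
set (v := vec (vA T) (vC T)) in *; set (w := vec (vA T) (vB T)) in *.
set (V := dot v v); set (W := dot w w); set (S := dot w v).
assert (Eb' : b * b = V)
  by (rewrite Eb; unfold V, v, dot, vec; simpl; ring).
assert (Ea' : a * a = W + V - 2 * S)
  by (rewrite Ea; unfold W, V, S, v, w, dot, vec; simpl; ring).
assert (Em' : h * h = W + V + 2 * S).
{ replace (h * h) with (4 * (h / 2 * (h / 2))) by field; rewrite Em.
  unfold W, V, S, v, w, median_foot_a, midpoint, dot, vec; simpl; field. }
assert (Es : dot (vec (vC T) (vA T)) (vec (vC T) (vB T)) = V - S)
  by (unfold V, S, v, w, dot, vec; simpl; ring).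
rewrite Es in H3; rewrite <- Eb, Eb' in H1.
pose proof (dot_cross_sq w v) as L; rewrite <- H1 in L; fold V W S in L.
(* Substituting [h^2 = W + V + 2S] into [S^2 + h^2 V = W V] leaves this square; [V + S] is twice the
   dot product of the median with [AC]. *)
assert (Z : (V + S) * (V + S) = 0) by nra.
assert (Z' : V + S = 0) by nra.
replace (V - S) with (2 * (b * b)) in H3 by lra.
rewrite Eb' in *; repeat split; lra.
Qed.

Lemma right_median_unique (T T' : plane_triangle) (h l : R) :
  0 < h -> has_data T h (h / 2) l -> has_data T' h (h / 2) l -> congruent T T'.
Proof.
intros Hh H H'.
destruct (triangle_sides_pos T) as [Hb Ha].
destruct (triangle_sides_pos T') as [Hb' Ha'].
destruct (has_data_right_median T h l Hh H) as (E1 & E2 & E3 & E4 & E5).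
destruct (has_data_right_median T' h l Hh H') as (F1 & F2 & F3 & F4 & F5).
assert (E : pdist (vC T) (vA T) = pdist (vC T') (vA T')).
{ destruct (Rtotal_order (pdist (vC T) (vA T)) (pdist (vC T') (vA T')))
    as [L | [L | L]]; [exfalso|exact L|exfalso].
  - exact (bisector_sq_increasing h l _ _ _ _ Hh Ha Hb Ha' L E1 F1 E2 F2).
  - exact (bisector_sq_increasing h l _ _ _ _ Hh Ha' Hb' Ha L F1 E1 F2 E2). }
rewrite <- E in F3, F4, F5.
apply congruent_of_eq_dots; lra.
Qed.

(** * Non-congruence and angles of the two triangles *)

Lemma Permutation_length_3_inv (X : Type) (x y z x' y' z' : X) :
  Permutation [x; y; z] [x'; y'; z'] ->
  (x = x' /\ y = y' /\ z = z') \/ (x = x' /\ y = z' /\ z = y') \/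
  (x = y' /\ y = x' /\ z = z') \/ (x = y' /\ y = z' /\ z = x') \/
  (x = z' /\ y = x' /\ z = y') \/ (x = z' /\ y = y' /\ z = x').
Proof.
intro H.
assert (Hx : In x [x'; y'; z'])
  by (apply (Permutation_in _ H); left; reflexivity).
destruct Hx as [Hx | [Hx | [Hx | []]]]; subst x.
- apply Permutation_cons_inv, Permutation_length_2 in H; tauto.
- assert (H' : Permutation [y'; y; z] [y'; x'; z'])
    by (rewrite H; apply perm_swap).
  apply Permutation_cons_inv, Permutation_length_2 in H'; tauto.
- assert (H' : Permutation [z'; y; z] [z'; x'; y'])
    by (rewrite H; apply (Permutation_app_comm [x'; y'] [z'])).
  apply Permutation_cons_inv, Permutation_length_2 in H'; tauto.
Qed.

Lemma opposite_abscissae_not_congruent (h k b b' : R) (T T' : plane_triangle) :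
  0 < h -> 0 < k -> 0 < b -> 0 < b' ->
  vA T = (0, 0) -> vB T = (2 * k - b, h) -> vC T = (b, 0) ->
  vA T' = (0, 0) -> vB T' = (2 * - k - b', h) -> vC T' = (b', 0) ->
  ~ congruent_figures T T'.
Proof.
intros Hh Hk Hb Hb' EA EB EC EA' EB' EC' (f & Hf & HP).
assert (iso : forall P Q, dot (vec (f P) (f Q)) (vec (f P) (f Q)) =
  dot (vec P Q) (vec P Q)) by (intros; rewrite <- !pdist_sq, Hf; reflexivity).
pose proof (iso (vA T) (vB T)) as R1.
pose proof (iso (vB T) (vC T)) as P1.
pose proof (iso (vC T) (vA T)) as Q1.
unfold vertices in HP; simpl in HP.
set (FA := f (vA T)) in *; set (FB := f (vB T)) in *; set (FC := f (vC T)) in *.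
rewrite EA, EB, EC in *; rewrite EA', EB', EC' in *; clearbody FA FB FC.
(* Heron's formula expresses the squared double area by the squared sides, which [f] preserves. *)
assert (area : cross (vec FA FB) (vec FA FC) * cross (vec FA FB) (vec FA FC) =
  b * b * (h * h)).
{ assert (heron : forall P Q X, cross (vec P Q) (vec P X) * cross (vec P Q) (vec P X) =
    dot (vec P Q) (vec P Q) * dot (vec X P) (vec X P) -
    (dot (vec P Q) (vec P Q) + dot (vec X P) (vec X P) - dot (vec Q X) (vec Q X)) *
    (dot (vec P Q) (vec P Q) + dot (vec X P) (vec X P) - dot (vec Q X) (vec Q X)) / 4)
    by (intros; unfold cross, dot, vec; simpl; field).
  rewrite heron, R1, P1, Q1, <- heron; unfold cross, vec; simpl; ring. }
apply Permutation_length_3_inv in HP.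
assert (Ebb : b = b').
{ assert (E : b' * b' * (h * h) = b * b * (h * h)).
  { rewrite <- area; decompose [and or] HP; subst FA FB FC;
      unfold cross, vec; simpl; ring. }
  apply Rmult_eq_reg_r in E; [|nra].
  apply Rsq_eq_nonneg; lra. }
subst b'; clear area; unfold dot, vec in R1, P1, Q1.
(* For equal [b] the sums of the three squared sides differ by [24 k b > 0], which excludes all six
   matchings. *)
decompose [and or] HP; subst FA FB FC; simpl in R1, P1, Q1; nra.
Qed.

(** The median ends at [(k, h / 2)] and [AC] runs along the positive first axis, so the cosine is
    [k / m]. *)
Lemma angle_median (T : plane_triangle) (h k b m : R) :
  0 < m -> 0 < b -> median_a T = m ->
  vA T = (0, 0) -> vB T = (2 * k - b, h) -> vC T = (b, 0) ->
  angle (median_foot_a T) (vA T) (vC T) = acos (k / m).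
Proof.
intros Hm Hb H EA EB EC; unfold angle; f_equal.
unfold median_a in H; rewrite H.
replace (pdist (vA T) (vC T)) with b
  by (symmetry; rewrite EA, EC; apply pdist_eq_intro; [lra|];
      unfold dot, vec; simpl; ring).
unfold median_foot_a, midpoint; rewrite EA, EB, EC.
unfold dot, vec; simpl; field; lra.
Qed.

(** Each claim uses the stronger notion: the two triangles differ even as unlabelled figures, while
    uniqueness respects the labels. *)
Theorem mainTheorem14 (S1 S2 S3 : R) (hS1 : 0 < S1) (hS2 : 0 < S2) (hS3 : 0 < S3) :
  (1 / 2 * S1 < S2 ->
     let alpha := asin (S1 / (2 * S2)) in
     0 < alpha < PI / 2 /\
     exists T1 T2 : plane_triangle,
       ~ congruent_figures T1 T2 /\
       has_data T1 S1 S2 S3 /\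
       has_data T2 S1 S2 S3 /\
       angle (median_foot_a T1) (vA T1) (vC T1) = alpha /\
       angle (median_foot_a T2) (vA T2) (vC T2) = PI - alpha) /\
  (1 / 2 * S1 = S2 ->
     exists T : plane_triangle,
       has_data T S1 S2 S3 /\
       forall T' : plane_triangle, has_data T' S1 S2 S3 -> congruent T T').
Proof.
split.
- intros H alpha.
  assert (Hx : 0 < S1 / (2 * S2) < 1).
  { split; [apply Rdiv_lt_0_compat; lra|].
    apply Rmult_lt_reg_r with (2 * S2); [lra|].
    replace (S1 / (2 * S2) * (2 * S2)) with S1 by (field; lra); lra. }
  assert (Hsin : sin alpha = S1 / (2 * S2)) by (apply sin_asin; lra).
  assert (Hal : 0 < alpha < PI / 2).
  { assert (B : - (PI / 2) < alpha < PI / 2) by (apply asin_bound_lt; lra).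
    split; [apply sin_increasing_0; rewrite ?sin_0; lra | apply B]. }
  split; [exact Hal|].
  assert (Hc : 0 < cos alpha) by (apply cos_gt_0; lra).
  assert (Hk : 0 < S2 * cos alpha) by (apply Rmult_lt_0_compat; assumption).
  (* Pythagoras with legs [S2 cos alpha] and [S1 / 2 = S2 sin alpha], for both signs of [k]. *)
  assert (Hm : forall k, k * k = S2 * cos alpha * (S2 * cos alpha) ->
    sqrt (k * k + S1 / 2 * (S1 / 2)) = S2).
  { intros k Ek; rewrite Ek.
    assert (E : S1 / 2 = S2 * sin alpha) by (rewrite Hsin; field; lra).
    rewrite E.
    pose proof (sin2_cos2 alpha) as P; unfold Rsqr in P.
    replace (S2 * cos alpha * (S2 * cos alpha) + S2 * sin alpha * (S2 * sin alpha))
      with (S2 * S2 * (sin alpha * sin alpha + cos alpha * cos alpha)) by ring.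
    rewrite P, Rmult_1_r; apply sqrt_square; lra. }
  destruct (triangle_of_median_abscissa S1 (S2 * cos alpha) S3 hS1 hS3)
    as (b1 & T1 & Hb1 & EA1 & EB1 & EC1 & D1).
  destruct (triangle_of_median_abscissa S1 (- (S2 * cos alpha)) S3 hS1 hS3)
    as (b2 & T2 & Hb2 & EA2 & EB2 & EC2 & D2).
  rewrite Hm in D1 by ring; rewrite Hm in D2 by ring.
  exists T1, T2; split; [|split; [exact D1|split; [exact D2|split]]].
  + exact (opposite_abscissae_not_congruent _ _ _ _ _ _ hS1 Hk Hb1 Hb2
      EA1 EB1 EC1 EA2 EB2 EC2).
  + rewrite (angle_median T1 _ _ _ _ hS2 Hb1 (proj1 (proj2 D1)) EA1 EB1 EC1).
    replace (S2 * cos alpha / S2) with (cos alpha) by (field; lra).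
    apply acos_cos; lra.
  + rewrite (angle_median T2 _ _ _ _ hS2 Hb2 (proj1 (proj2 D2)) EA2 EB2 EC2).
    replace (- (S2 * cos alpha) / S2) with (- cos alpha) by (field; lra).
    rewrite acos_opp, acos_cos; lra.
- intro H.
  replace S2 with (S1 / 2) by lra.
  destruct (triangle_of_median_abscissa S1 0 S3 hS1 hS3)
    as (b & T & _ & _ & _ & _ & D).
  replace (sqrt (0 * 0 + S1 / 2 * (S1 / 2))) with (S1 / 2) in D
    by (rewrite Rmult_0_l, Rplus_0_l, sqrt_square; lra).
  exists T; split; [exact D|].
  intros T' D'; exact (right_median_unique T T' S1 S3 hS1 D D').
Qed.
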